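(* The statement $\bigtriangledown$ (every separative poset $\mathbb P$ satisfies $\pi\mathrm{nt}(\mathbb P)\le S(\mathbb P)$) is equivalent to each of the following statements: (1) For every Boolean algebra $\mathbb B$, $\pi\mathrm{nt}(\mathbb B)\le S(\mathbb B)$. (2) For every Stone space (zero-dimensional compact Hausdorff space) $X$, $\pi\mathrm{nt}(X)\le S(X)$. (3) For every quasi-regular space $X$, $\pi\mathrm{nt}(X)\le S(X)$.
   Context: Posets: $q\le p$ means $q$ extends $p$; $p,q$ are incompatible if they have no common extension; $\mathbb P$ is separative if whenever $q\not\le p$ there is $r\le q$ incompatible with $p$. $\mathbb P$ has the $\kappa$-cc if every antichain has size $<\kappa$; $S(\mathbb P)$ is the least $\kappa$ such that $\mathbb P$ has the $\kappa$-cc. $\mathbb D\subseteq\mathbb P$ is dense if every $p\in\mathbb P$ has an extension in $\mathbb D$. For $\mathbb D\subseteq\mathbb P$, $\mathrm{nt}(\mathbb D)$ is the least cardinal $\kappa$ such that for all $q\in\mathbb P$, $|\{p\in\mathbb D:q\le p\}|<\kappa$; $\pi\mathrm{nt}(\mathbb P)=\min\{\mathrm{nt}(\mathbb D):\mathbb D\text{ dense}\}$. A Boolean algebra $\mathbb B$ is regarded as the poset of its nonzero elements under its order. Spaces: a cellular family in $X$ is a family of pairwise disjoint nonempty open sets; $S(X)$ is the least cardinal $\kappa$ such that $X$ has no cellular family of size $\kappa$. A $\pi$-base is a family $\mathcal B$ of nonempty open sets such that every nonempty open set contains a member of $\mathcal B$; $\mathrm{nt}(\mathcal B)$ is the least $\kappa$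 such that for every nonempty open $U$, $|\{V\in\mathcal B:U\subseteq V\}|<\kappa$; $\pi\mathrm{nt}(X)$ is the minimum of $\mathrm{nt}(\mathcal B)$ over $\pi$-bases $\mathcal B$ of $X$. $X$ is quasi-regular if it is Hausdorff and every nonempty open $U$ contains a nonempty open $V$ with $\overline V\subseteq U$. *)

(* Defs.v *)
From HB Require Import structures.
From mathcomp Require Import all_boot all_order.
From mathcomp Require Import all_classical.
From mathcomp Require Import topology.

Set Implicit Arguments.
Unset Strict Implicit.
Unset Printing Implicit Defensive.

Import Order.TTheory.
Local Open Scope order_scope.
Local Open Scope card_scope.
Local Open Scope classical_set_scope.

(* A cardinal is represented by any type K of that cardinality, i.e. by the
   cardinality of [set: K].  Two such types are the same cardinal when
   [set: K] #= [set: L], and the order on cardinals is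
   [set: K] #<= [set: L]. *)

(* |A| < |K| *)
Definition card_lt (T : Type) (A : set T) (K : Type) : Prop :=
  A #<= [set: K] /\ ~ ([set: K] #<= A).

Definition is_least_card (Q : Type -> Prop) (K : Type) : Prop :=
  Q K /\ forall L : Type, Q L -> [set: K] #<= [set: L].

(* Cardinals are well ordered: a family of subsets of A has a member of least
   cardinality, obtained from a maximal system of simultaneous injections. *)
Lemma least_subset (A : Type) (F : set (set A)) :
  F !=set0 -> exists2 X, F X & forall Y, F Y -> X #<= Y.
Proof.
move=> [X0 FX0].
pose I := {X | F X}.
pose P : set (set (I -> A)) := [set G |
  (forall g i, G g -> sval i (g i)) /\
  (forall g h i, G g -> G h -> g i = h i -> g = h)].
have [|G [[G1 G2] Gmax]] := @Zorn_bigcup _ P.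
  move=> H HP Htot; split.
    by move=> g i [G HG Gg]; have [+ _] := HP _ HG; apply.
  move=> g h i [G HG Gg] [G' HG' Gh] gh.
  have [GG'|G'G] := Htot _ _ HG HG'.
    by have [_ K] := HP _ HG'; apply: (K _ _ i) => //; exact: GG'.
  by have [_ K] := HP _ HG; apply: (K _ _ i) => //; exact: G'G.
have [i Gi] : exists i : I, sval i `<=` [set g i | g in G].
  apply: contrapT => /forallNP nG.
  have /choice[g gP] : forall i : I, exists x, sval i x /\
      ~ [set g i | g in G] x.
    by move=> i; have /existsNP[x /not_implyP] := nG i; exists x.
  apply: (Gmax (g |` G)).
    split; first by move=> h; right.
    move=> /(_ g (or_introl erefl)) Gg.
    by have [_] := gP (exist _ X0 FX0); apply; exists g.
  split.
    by move=> h i; case=> [->|]; [have [] := gP i | exact: G1].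
  move=> h k i [->|Gh] [->|Gk] // hk.
  - by have [_] := gP i; case; exists k.
  - by have [_] := gP i; case; exists h.
  - exact: G2 hk.
exists (sval i); first exact: svalP.
move=> Y FY; pose j : I := exist _ Y FY.
apply: (card_le_trans (subset_card_le Gi)).
apply: (card_le_trans (card_image_le _ _)).
have inj : {in G &, injective (fun g : I -> A => g j)}.
  by move=> g h /set_mem Gg /set_mem Gh; exact: G2.
apply/card_subP; exists [set g j | g in G]; first exact: inj_card_eq.
by move=> _ [g Gg <-]; exact: (G1 g j Gg).
Qed.

Lemma card_le_total (T U : Type) (A : set T) (B : set U) :
  A #<= B \/ B #<= A.
Proof.
pose F : set (set (T + U)) := [set inl @` A; inr @` B].
have EA : (@inl T U) @` A #= A by apply: inj_card_eq => x y _ _ [].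
have EB : (@inr T U) @` B #= B by apply: inj_card_eq => x y _ _ [].
have [|X [->|->] Xmin] := @least_subset _ F; first by exists (inl @` A); left.
- left; rewrite -(card_le_eql EA) -(card_le_eqr EB).
  by apply: Xmin; right.
- right; rewrite -(card_le_eql EB) -(card_le_eqr EA).
  by apply: Xmin; left.
Qed.

Lemma ex_least_card (Q : Type -> Prop) (K0 : Type) :
  Q K0 -> exists K, is_least_card Q K.
Proof.
move=> QK0.
pose F : set (set K0) := [set X | exists2 K, Q K & X #= [set: K]].
have [|X [K QK XK] Xmin] := @least_subset _ F.
  by exists setT; exists K0 => //; exact: card_eqxx.
have KK0 : [set: K] #<= [set: K0].
  by rewrite -(card_le_eql XK); exact: card_leT.
exists K; split=> // L QL.
have [K0L|] := card_le_total [set: K0] [set: L].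
  exact: card_le_trans KK0 K0L.
move=> /card_subP[Y YL _].
by rewrite -(card_le_eql XK) -(card_le_eqr YL); apply: Xmin; exists L.
Qed.

(* The least cardinal satisfying Q; empty if no cardinal satisfies Q. *)
Definition least_card (Q : Type -> Prop) : Type :=
  if pselect (exists K, is_least_card Q K) is left h then sval (cid h)
  else False.

Lemma least_cardP (Q : Type -> Prop) (K0 : Type) :
  Q K0 -> is_least_card Q (least_card Q).
Proof.
move=> /ex_least_card h; rewrite /least_card.
by case: pselect => // h'; exact: svalP.
Qed.

Lemma card_lt_powerset (T : Type) (A : set T) : card_lt A (set T).
Proof.
split.
  apply/card_subP; exists [set [set x] | x in A]; last by [].
  apply: inj_card_eq => x y _ _ xy.
  have : [set x] x by [].
  by rewrite xy.
move=> setA; have /card_leP[f] := card_le_trans setA (card_leT A).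
pose g (X : set T) : T := val (f (to_setT X)).
have ginj X Y : g X = g Y -> X = Y.
  by move=> /val_inj /inj H; have := H (mem_set I) (mem_set I); case.
pose D : set T := [set x | exists X, x = g X /\ ~ X x].
have nD : ~ D (g D) by move=> DgD; have [X [/ginj <-]] := DgD; apply.
by apply: (nD); exists D.
Qed.

Section Posets.
Context {d : Order.disp_t} {P : porderType d}.
Implicit Types (p q r : P) (A D : set P).

Definition incompatible p q := ~ exists r, r <= p /\ r <= q.

Definition antichain A :=
  forall p q, A p -> A q -> p <> q -> incompatible p q.

Definition dense_subset D := forall p, exists2 r, D r & r <= p.

Definition nt D : Type :=
  least_card (fun K => forall q, card_lt [set p | D p /\ q <= p] K).

Lemma ntP D : is_least_card
  (fun K => forall q, card_lt [set p | D p /\ q <= p] K) (nt D).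
Proof. by apply: (@least_cardP _ (set P)) => q; exact: card_lt_powerset. Qed.

End Posets.

Section PosetCardinals.
Context {d : Order.disp_t} (P : porderType d).

Definition separative :=
  forall p q : P, ~ (q <= p) -> exists2 r, r <= q & incompatible r p.

(* the kappa-chain condition, with kappa the cardinality of K *)
Definition has_cc (K : Type) := forall A : set P, antichain A -> card_lt A K.

(* S(P) *)
Definition souslin : Type := least_card has_cc.

Lemma souslinP : is_least_card has_cc souslin.
Proof. by apply: (@least_cardP _ (set P)) => A _; exact: card_lt_powerset. Qed.

Definition pi_nt : Type := least_card
  (fun K => exists2 D : set P, dense_subset D & [set: K] #= [set: nt D]).

Lemma pi_ntP : is_least_card
  (fun K => exists2 D : set P, dense_subset D & [set: K] #= [set: nt D]) pi_nt.
Proof.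
apply: (@least_cardP _ (nt [set: P])); exists setT; last exact: card_eqxx.
by move=> p; exists p.
Qed.

End PosetCardinals.

Section NonzeroElements.
Context {d : Order.disp_t} (B : ctbDistrLatticeType d).

Definition nonzero : Type := {b : B | b != \bot}.

HB.instance Definition _ := SubChoice.on nonzero.
HB.instance Definition _ := [SubChoice_isSubPOrder of nonzero by <: with d].

End NonzeroElements.

Section Spaces.
Context (X : topologicalType).
Implicit Types (U V : set X) (B C : set (set X)).

Definition nonempty_open U := open U /\ U !=set0.

Definition cellular C :=
  C `<=` nonempty_open /\
  forall U V, C U -> C V -> U <> V -> U `&` V = set0.

(* S(X) *)
Definition souslin_space : Type :=
  least_card (fun K => ~ exists2 C, cellular C & C #= [set: K]).

Lemma souslin_spaceP : is_least_card
  (fun K => ~ exists2 C, cellular C & C #= [set: K]) souslin_space.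
Proof.
apply: (@least_cardP _ (set (set X))) => -[C _ CK].
by have [_] := card_lt_powerset C; apply; have /card_eqPle[] := CK.
Qed.

Definition pi_base B :=
  B `<=` nonempty_open /\
  forall U, nonempty_open U -> exists2 V, B V & V `<=` U.

Definition nt_pi_base B : Type := least_card
  (fun K => forall U, nonempty_open U -> card_lt [set V | B V /\ U `<=` V] K).

Lemma nt_pi_baseP B : is_least_card
  (fun K => forall U, nonempty_open U -> card_lt [set V | B V /\ U `<=` V] K)
  (nt_pi_base B).
Proof.
by apply: (@least_cardP _ (set (set X))) => U _; exact: card_lt_powerset.
Qed.

Definition pi_nt_space : Type := least_card
  (fun K => exists2 B, pi_base B & [set: K] #= [set: nt_pi_base B]).

Lemma pi_nt_spaceP : is_least_card
  (fun K => exists2 B, pi_base B & [set: K] #= [set: nt_pi_base B]) pi_nt_space.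
Proof.
apply: (@least_cardP _ (nt_pi_base nonempty_open)).
exists nonempty_open; last exact: card_eqxx.
by split=> // U oU; exists U.
Qed.

(* The clopen sets form a base.  The library's zero_dimensional only asks that
   clopen sets separate points, which in general is weaker. *)
Definition clopen_base := forall (x : X) U, open U -> U x ->
  exists V, [/\ clopen V, V x & V `<=` U].

Definition stone_space :=
  [/\ hausdorff_space X, compact [set: X] & clopen_base].

Definition quasi_regular := hausdorff_space X /\
  forall U, nonempty_open U ->
    exists V, [/\ nonempty_open V, V `<=` U & closure V `<=` U].

End Spaces.

Definition card_leq (K L : Type) : Prop := [set: K] #<= [set: L].

Definition separative_pi_nt_le : Prop :=
  forall (d : Order.disp_t) (P : porderType d),
    separative P -> card_leq (pi_nt P) (souslin P).

(* Main.v *)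
Require Import Defs.
From HB Require Import structures.
From mathcomp Require Import all_boot all_order.
From mathcomp Require Import all_classical.
From mathcomp Require Import topology.

(* A dense order embedding P -> Q preserves and reflects pi_nt <= S: a dense subset
   is moved along it by choosing, below each of its members, an element coming
   from the other side, and then a set of members above a given element is an
   image of such a set on the other side; antichains move the same way.  The
   cardinal invariants of a space X are those of the poset of its nonempty open
   sets.  Three dense embeddings thus close the circle of implications:
   the nonzero regular open sets of a quasi-regular X into its nonempty open
   sets, the nonzero elements of a Boolean algebra into the nonempty open sets
   of its Stone space, and a separative P, through the cones {q | q <= p}, into
   the nonzero regular open sets of P under the topology of down-closed sets. *)

Set Implicit Arguments.
Unset Strict Implicit.
Unset Printing Implicit Defensive.

Import Order.Theory.
Local Open Scope order_scope.
Local Open Scope card_scope.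
Local Open Scope classical_set_scope.

(** * Comparison of least cardinals *)

Lemma card_lt_le (T U : Type) (A : set T) (B : set U) (K : Type) :
  A #<= B -> card_lt B K -> card_lt A K.
Proof.
move=> AB [BK nKB]; split; first exact: card_le_trans AB BK.
by move=> KA; apply: nKB; exact: card_le_trans KA AB.
Qed.

(** [L] may differ from [K] because [pi_nt] is a minimum over dense sets: replacing one dense set by
    another changes the cardinal, and it suffices that it does not grow. *)
Lemma is_least_card_le (Q1 Q2 : Type -> Prop) (K1 K2 : Type) :
  is_least_card Q1 K1 -> is_least_card Q2 K2 ->
  (forall K, Q1 K -> exists2 L, Q2 L & [set: L] #<= [set: K]) ->
  [set: K2] #<= [set: K1].
Proof.
move=> [Q1K1 _] [_ K2min] /(_ _ Q1K1)[L Q2L LK1].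
exact: card_le_trans (K2min _ Q2L) LK1.
Qed.

Lemma is_least_card_sub (Q1 Q2 : Type -> Prop) (K1 K2 : Type) :
  is_least_card Q1 K1 -> is_least_card Q2 K2 ->
  (forall K, Q1 K -> Q2 K) -> [set: K2] #<= [set: K1].
Proof.
move=> l1 l2 Q12; apply: (is_least_card_le l1 l2) => K /Q12 Q2K.
by exists K => //; exact: card_lexx.
Qed.

(** * Invariance under dense order embeddings *)

Section DenseEmbedding.
Context {d d' : Order.disp_t} {P : porderType d} {Q : porderType d'}.
Variable e : P -> Q.
Hypothesis e_le : forall p q, (e p <= e q) = (p <= q).
Hypothesis e_dense : forall q, exists p, e p <= q.

(** With [f b] chosen so that [e (f b) <= b], [q <= f b] gives [e q <= b]. So the members of the
    image of [D] above [q] are values of [f] on members of [D] above [e q]. *)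
Lemma pi_nt_embed_le : [set: pi_nt P] #<= [set: pi_nt Q].
Proof.
have /choice[f ef] := e_dense.
apply: (is_least_card_le (pi_ntP Q) (pi_ntP P)) => K [D dD KD].
exists (nt (f @` D)).
  exists (f @` D) => [p|]; last exact: card_eqxx.
  have [b Db bp] := dD (e p); exists (f b); first by exists b.
  by rewrite -e_le; exact: le_trans (ef b) bp.
rewrite (card_le_eqr KD).
apply: (is_least_card_sub (ntP D) (ntP (f @` D))) => L DL q.
apply: card_lt_le (DL (e q)).
apply: card_le_trans (card_image_le f _); apply: subset_card_le.
move=> _ [[b Db <-] qfb]; exists b => //; split=> //.
by apply: le_trans (ef b); rewrite e_le.
Qed.

(** The dense set is transported by [e] itself. The choice [f] only supplies a point [e (f q)] below
    [q], so that whatever lies above [q] comes from members of [D] above [f q]. *)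
Lemma pi_nt_embed_ge : [set: pi_nt Q] #<= [set: pi_nt P].
Proof.
have /choice[f ef] := e_dense.
apply: (is_least_card_le (pi_ntP P) (pi_ntP Q)) => K [D dD KD].
exists (nt (e @` D)).
  exists (e @` D) => [q|]; last exact: card_eqxx.
  have [p Dp pq] := dD (f q); exists (e p); first by exists p.
  by apply: le_trans (ef q); rewrite e_le.
rewrite (card_le_eqr KD).
apply: (is_least_card_sub (ntP D) (ntP (e @` D))) => L DL q.
apply: card_lt_le (DL (f q)).
apply: card_le_trans (card_image_le e _); apply: subset_card_le.
move=> _ [[p Dp <-] qep]; exists p => //; split=> //.
by rewrite -e_le; exact: le_trans (ef q) qep.
Qed.

Lemma souslin_embed_ge : [set: souslin Q] #<= [set: souslin P].
Proof.
have /choice[f ef] := e_dense.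
apply: (is_least_card_sub (souslinP P) (souslinP Q)) => K PK A aA.
(* Two members of [A] with the same value under [f] are both above [e (f a)], hence compatible,
   hence equal. *)
have finj : {in A &, injective f}.
  move=> a b /set_mem Aa /set_mem Ab fab; apply: contrapT => /(aA _ _ Aa Ab).
  by apply; exists (e (f a)); split; [|rewrite fab]; exact: ef.
apply: (@card_lt_le _ _ _ (f @` A)).
  by rewrite (card_le_eqr (inj_card_eq finj)) card_lexx.
apply: PK => _ _ [a Aa <-] [b Ab <-] fafb [r [rfa rfb]].
apply: (aA _ _ Aa Ab); first by move=> ab; apply: fafb; rewrite ab.
by exists (e r); split;
  [apply: le_trans (ef a) | apply: le_trans (ef b)]; rewrite e_le.
Qed.

Lemma souslin_embed_le : [set: souslin P] #<= [set: souslin Q].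
Proof.
have /choice[f ef] := e_dense.
apply: (is_least_card_sub (souslinP Q) (souslinP P)) => K QK A aA.
have einj : injective e.
  by move=> p q epq; apply: le_anti; rewrite -!e_le epq lexx.
apply: (@card_lt_le _ _ _ (e @` A)).
  by rewrite (card_le_eqr (inj_card_eq (in2W einj))) card_lexx.
apply: QK => _ _ [p Ap <-] [q Aq <-] epq [r [rp rq]].
apply: (aA _ _ Ap Aq); first by move=> pq; apply: epq; rewrite pq.
(* The common extension [r] need not come from [P], but [e (f r)] below it does, and [e] reflects
   the order. *)
by exists (f r); split; rewrite -e_le; exact: le_trans (ef r) _.
Qed.

Lemma pi_nt_le_souslin_embed :
  card_leq (pi_nt P) (souslin P) <-> card_leq (pi_nt Q) (souslin Q).
Proof.
rewrite /card_leq; split=> H.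
  apply: card_le_trans pi_nt_embed_ge _.
  exact: card_le_trans H souslin_embed_le.
apply: card_le_trans pi_nt_embed_le _.
exact: card_le_trans H souslin_embed_ge.
Qed.

End DenseEmbedding.

(** * A space and the poset of its nonempty open sets *)

Section NonemptyOpens.
Variable X : topologicalType.

(** The boolean form of the predicate makes this a subtype of [set X], which then inherits inclusion
    as its order. *)
Definition opens : Type := {U : set X | `[< nonempty_open U >]}.

HB.instance Definition _ := SubChoice.on opens.
HB.instance Definition _ :=
  [SubChoice_isSubPOrder of opens by <: with set_display].

Lemma opensP (u : opens) : nonempty_open (val u).
Proof. by apply/asboolP; exact: (valP u). Qed.

Lemma opens_ex (U : set X) : nonempty_open U -> exists u : opens, val u = U.
Proof. by move=> /asboolP oU; exists (exist _ U oU). Qed.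

Lemma opens_le (u v : opens) : u <= v <-> val u `<=` val v.
Proof. by rewrite leEsub subsetEset. Qed.

Lemma nt_opens (D : set opens) :
  [set: nt D] #= [set: nt_pi_base (val @` D)].
Proof.
have E (q : opens) : [set V | (val @` D) V /\ val q `<=` V] #=
    [set p | D p /\ q <= p].
  rewrite -(_ : val @` [set p | D p /\ q <= p] =
    [set V | (val @` D) V /\ val q `<=` V]); last first.
    apply/seteqP; split=> [_ [p [Dp qp] <-]|_ [[p Dp <-] qp]].
      by split; [exists p | exact/opens_le].
    by exists p => //; split=> //; exact/opens_le.
  by apply: inj_card_eq => u v _ _ /val_inj.
rewrite card_eq_le; apply/andP; split.
  apply: (is_least_card_sub (nt_pi_baseP _) (ntP D)) => K H q.
  by apply: card_lt_le (H _ (opensP q)); have /card_eqPle[] := E q.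
apply: (is_least_card_sub (ntP D) (nt_pi_baseP _)) => K H _ /opens_ex[q <-].
by apply: card_lt_le (H q); have /card_eqPle[] := E q.
Qed.

Lemma pi_base_opens (D : set opens) : dense_subset D <-> pi_base (val @` D).
Proof.
split=> [dD|[_ bD] p].
  split=> [_ [p _ <-]|_ /opens_ex[p <-]]; first exact: opensP.
  have [q Dq /opens_le qp] := dD p.
  by exists (val q) => //; exists q.
by have [_ [q Dq <-] qp] := bD _ (opensP p); exists q => //; exact/opens_le.
Qed.

Lemma pi_nt_opens : [set: pi_nt opens] #= [set: pi_nt_space X].
Proof.
rewrite card_eq_le; apply/andP; split.
  apply: (is_least_card_sub (pi_nt_spaceP X) (pi_ntP _)) => K [B bB KB].
  pose D : set opens := [set u | B (val u)].
  have DB : val @` D = B.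
    apply/seteqP; split=> [_ [u Du <-]//|U BU].
    by have [u uU] := opens_ex (bB.1 _ BU); exists u; rewrite // /D /= uU.
  exists D; first by apply/pi_base_opens; rewrite DB.
  by apply: card_eq_trans KB _; rewrite card_eq_sym -DB; exact: nt_opens.
apply: (is_least_card_sub (pi_ntP _) (pi_nt_spaceP X)) => K [D dD KD].
exists (val @` D); first exact/pi_base_opens.
exact: card_eq_trans KD (nt_opens D).
Qed.

Lemma opens_incompatible (u v : opens) :
  incompatible u v <-> val u `&` val v = set0.
Proof.
split=> [uv|uv0 [w [/opens_le wu /opens_le wv]]].
  apply: contrapT => /eqP/set0P uv0; apply: uv.
  have [|w wE] := @opens_ex (val u `&` val v).
    by split=> //; apply: openI; [have [] := opensP u | have [] := opensP v].
  by exists w; split; apply/opens_le; rewrite wE => x [].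
have [_ [x wx]] := opensP w.
have : (val u `&` val v) x by split; [exact: wu | exact: wv].
by rewrite uv0.
Qed.

Lemma cellular_opens (A : set opens) : antichain A <-> cellular (val @` A).
Proof.
split=> [aA|[_ cA] u v Au Av uv].
  split=> [_ [u _ <-]|_ _ [u Au <-] [v Av <-] uv]; first exact: opensP.
  by apply/opens_incompatible/aA => // E; apply: uv; rewrite E.
apply/opens_incompatible/cA; [by exists u|by exists v|].
by move=> /val_inj.
Qed.

(** The poset version bounds every antichain strictly below [K], the space version only forbids
    cellular families of size exactly [K]. They agree because subfamilies of antichains are
    antichains, so one of size at least [K] contains one of size [K], and because cardinals are
    comparable. *)
Lemma souslin_opens : [set: souslin opens] #= [set: souslin_space X].
Proof.
have valA (A : set opens) : val @` A #= A.
  by apply: inj_card_eq => u v _ _ /val_inj.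
rewrite card_eq_le; apply/andP; split.
  apply: (is_least_card_sub (souslin_spaceP X) (souslinP _)) => K nK A aA.
  have nKA : ~ ([set: K] #<= A).
    move=> /card_subP[A' A'K A'A]; apply: nK.
    exists (val @` A'); last exact: card_eq_trans (valA _) A'K.
    by apply/cellular_opens => u v /A'A Au /A'A Av; exact: aA.
  by split=> //; have [] := card_le_total A [set: K].
apply: (is_least_card_sub (souslinP _) (souslin_spaceP X)) => K ccK.
move=> [C cC CK]; pose A : set opens := [set u | C (val u)].
have AC : val @` A = C.
  apply/seteqP; split=> [_ [u Au <-]//|U CU].
  by have [u uU] := opens_ex (cC.1 _ CU); exists u; rewrite // /A /= uU.
have /ccK[_] : antichain A by apply/cellular_opens; rewrite AC.
by apply; rewrite -(card_le_eqr (valA A)) AC; have /card_eqPle[] := CK.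
Qed.

Lemma pi_nt_le_souslin_opens : card_leq (pi_nt opens) (souslin opens) <->
  card_leq (pi_nt_space X) (souslin_space X).
Proof.
by rewrite /card_leq (card_le_eql pi_nt_opens) (card_le_eqr souslin_opens).
Qed.

End NonemptyOpens.

(** * The Boolean algebra of regular open sets *)

Section RegularOpens.
Variable X : topologicalType.

Definition regular_opens : Type := {U : set X | `[< regopen U >]}.

HB.instance Definition _ := SubChoice.on regular_opens.
HB.instance Definition _ :=
  [SubChoice_isSubPOrder of regular_opens by <: with set_display].

Lemma regopenP (u : regular_opens) : regopen (val u).
Proof. by apply/asboolP; exact: (valP u). Qed.

Lemma regopen_open (U : set X) : regopen U -> open U.
Proof. by move=> <-; exact: open_interior. Qed.

Lemma open_sub_interior_closure (U : set X) :
  open U -> U `<=` interior (closure U).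
Proof. by move=> oU; rewrite -open_subsetE//; exact: subset_closure. Qed.

Lemma interior_closure_min (U W : set X) :
  regopen W -> U `<=` W -> interior (closure U) `<=` W.
Proof. by move=> rW UW; rewrite -rW; exact/interiorS/closureS. Qed.

(** Near a point of the open set [W], neighbourhoods can be shrunk into [W]; if the point is in the
    closure of [U], they therefore meet [U] inside [W]. This is the source of distributivity. *)
Lemma interior_closureIl (U W : set X) : open W ->
  interior (closure U) `&` W `<=` interior (closure (U `&` W)).
Proof.
move=> oW; rewrite -open_subsetE; last exact/openI/oW/open_interior.
move=> x [/interior_subset Ux Wx] N Nx.
have [y [Uy [Ny Wy]]] := Ux _ (filterI Nx (open_nbhs_nbhs (conj oW Wx))).
by exists y.
Qed.

Lemma regular_opens_le (u v : regular_opens) : u <= v <-> val u `<=` val v.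
Proof. by rewrite leEsub subsetEset. Qed.

Definition regopen_of (U : set X) (rU : regopen U) : regular_opens :=
  exist _ U (asboolT rU).

Lemma regopen_setI (U V : set X) :
  regopen U -> regopen V -> regopen (U `&` V).
Proof.
move=> rU rV; apply/seteqP; split.
  by move=> x UVx; split; move: x UVx; apply: interior_closure_min => // x [].
by apply/open_sub_interior_closure/openI; exact: regopen_open.
Qed.

Lemma regopen_interior_setC (U : set X) : open U -> regopen (interior (~` U)).
Proof. by move=> oU; apply/interior_closed_regopen/open_closedC. Qed.

Lemma regopen0 : regopen (@set0 X).
Proof. by rewrite /regopen closure0 interior0. Qed.

Lemma regopenT : regopen [set: X].
Proof. by rewrite /regopen closureT interiorT. Qed.

Definition ro_meet (u v : regular_opens) : regular_opens :=
  regopen_of (regopen_setI (regopenP u) (regopenP v)).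

(** The underlying set, implicit in [interior_closure_idem], is the interior of the closure of the
    union, since the union itself need not be regular open. *)
Definition ro_join (u v : regular_opens) : regular_opens :=
  regopen_of (interior_closure_idem (val u `|` val v)).

Definition ro_compl (u : regular_opens) : regular_opens :=
  regopen_of (regopen_interior_setC (regopen_open (regopenP u))).

Lemma ro_meetP (u v w : regular_opens) :
  (u <= ro_meet v w) = (u <= v) && (u <= w).
Proof.
apply/idP/andP => [/regular_opens_le uvw|[/regular_opens_le uv]].
  by split; apply/regular_opens_le => x /uvw[].
move=> /regular_opens_le uw; apply/regular_opens_le => x ux.
by split; [exact: uv | exact: uw].
Qed.

Lemma ro_joinP (u v w : regular_opens) :
  (ro_join u v <= w) = (u <= w) && (v <= w).
Proof.
have /open_sub_interior_closure uvE : open (val u `|` val v).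
  by apply: openU; exact/regopen_open/regopenP.
apply/idP/andP => [/regular_opens_le uvw|[/regular_opens_le uw]].
  by split; apply/regular_opens_le => x ?; apply/uvw/uvE; [left | right].
move=> /regular_opens_le vw; apply/regular_opens_le.
by apply: interior_closure_min; [exact: regopenP | move=> x [/uw|/vw]].
Qed.

HB.instance Definition _ :=
  Order.POrder_MeetJoin_isLattice.Build set_display regular_opens
    ro_meetP ro_joinP.

(** One inequality holds in every lattice. The other is [interior_closureIl] applied to the union of
    [u] and [v] and to the open set [w]. *)
Lemma ro_meetUl :
  left_distributive (@Order.meet _ regular_opens) (@Order.join _ regular_opens).
Proof.
move=> u v w; apply: le_anti; apply/andP; split; last first.
  by rewrite leUx !leI2// (leUl, leUr).
apply/regular_opens_le; have ow := regopen_open (regopenP w).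
by apply: subset_trans (interior_closureIl ow) _; rewrite setIUl.
Qed.

HB.instance Definition _ :=
  Order.Lattice_Meet_isDistrLattice.Build set_display regular_opens ro_meetUl.

Lemma ro_le0x (u : regular_opens) : regopen_of regopen0 <= u.
Proof. by apply/regular_opens_le => x. Qed.

Lemma ro_lex1 (u : regular_opens) : u <= regopen_of regopenT.
Proof. by apply/regular_opens_le => x. Qed.

HB.instance Definition _ :=
  Order.hasBottom.Build set_display regular_opens ro_le0x.
HB.instance Definition _ :=
  Order.hasTop.Build set_display regular_opens ro_lex1.

(** The closures of [u] and of its exterior already cover the space: a point outside the closure of
    [u] lies in the exterior. *)
Lemma ro_joinxC (u : regular_opens) : (u `|` ro_compl u = \top)%O.
Proof.
apply: val_inj => /=; rewrite closureU.
rewrite -subTset -[X in X `<=` _]interiorT; apply: interiorS => x _.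
have [|ux] := pselect (closure (val u) x); first by left.
by right; apply: subset_closure; rewrite interiorC.
Qed.

Lemma ro_meetxC (u : regular_opens) : (u `&` ro_compl u = \bot)%O.
Proof.
by apply: val_inj; apply/seteqP; split=> x // -[/= ux /interior_subset].
Qed.

HB.instance Definition _ :=
  Order.TBDistrLattice_hasComplement.Build set_display regular_opens
    ro_joinxC ro_meetxC.

Lemma ro_neq_bot (u : regular_opens) : (u != \bot) <-> val u !=set0.
Proof.
split=> [u0|/set0P]; [apply/set0P; move: u0|]; apply: contra => /eqP E.
  by apply/eqP/val_inj.
by rewrite E.
Qed.

Lemma nonzero_open (u : nonzero regular_opens) : nonempty_open (val (val u)).
Proof.
split; first exact/regopen_open/regopenP.
by apply/ro_neq_bot; exact: (valP u).
Qed.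

Definition opens_of_nonzero (u : nonzero regular_opens) : opens X :=
  exist _ (val (val u)) (asboolT (nonzero_open u)).

Lemma opens_of_nonzero_le (u v : nonzero regular_opens) :
  (opens_of_nonzero u <= opens_of_nonzero v) = (u <= v).
Proof. by rewrite !leEsub. Qed.

(** Quasi-regularity enters here. The interior of the closure of an open subset of [U] may leave
    [U], but not when that closure is contained in [U]. *)
Lemma opens_of_nonzero_dense : quasi_regular X ->
  forall U : opens X, exists u, opens_of_nonzero u <= U.
Proof.
move=> [_ qr] U; have [V [[oV [x Vx]] _ VU]] := qr _ (opensP U).
pose u := regopen_of (interior_closure_idem V).
have u0 : u != \bot.
  by apply/ro_neq_bot; exists x; exact: open_sub_interior_closure.
exists (exist _ u u0); apply/opens_le.
exact: subset_trans (@interior_subset _ _) VU.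
Qed.

End RegularOpens.

(** * Separative posets inside regular open algebras *)

Section Alexandrov.
Context {d : Order.disp_t} (P : porderType d).

(** An alias, so that the topology is attached to this copy and not to [P] itself. *)
Definition alexandrov : Type := P.

HB.instance Definition _ := Choice.copy alexandrov P.

Definition down_closed (U : set alexandrov) :=
  forall p q : P, q <= p -> U p -> U q.

Lemma down_closedT : down_closed setT. Proof. by []. Qed.

Lemma down_closedI : setI_closed down_closed.
Proof. by move=> U V dU dV p q qp [/(dU _ _ qp) Uq /(dV _ _ qp)]. Qed.

Lemma down_closed_bigcup (I : Type) (f : I -> set alexandrov) :
  (forall i, down_closed (f i)) -> down_closed (\bigcup_i f i).
Proof. by move=> df p q qp [i _ /(df i _ _ qp) fiq]; exists i. Qed.

HB.instance Definition _ := isOpenTopological.Build alexandrov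
  down_closedT down_closedI down_closed_bigcup.

Definition cone (p : P) : set alexandrov := [set q | q <= p].

Lemma nbhs_alexandrov (p : alexandrov) (U : set alexandrov) :
  nbhs p U <-> cone p `<=` U.
Proof.
rewrite nbhsE; split=> [[V [oV Vp] VU] q qp|pU].
  by apply: VU; exact: oV qp Vp.
exists (cone p) => //; split; last exact: lexx.
by move=> q r rq qp; exact: le_trans rq qp.
Qed.

(** [cone p] is the least neighbourhood of [p], so closure means having an extension in [U], and the
    interior of the closure consists of the [p] below which [U] is dense. *)
Lemma interior_closure_alexandrov (U : set alexandrov) (p : P) :
  interior (closure U) p <-> forall q, q <= p -> exists2 r, r <= q & U r.
Proof.
split=> [/nbhs_alexandrov pU q /pU Uq|pU].
  have [|r [Ur rq]] := Uq (cone q); last by exists r.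
  exact/nbhs_alexandrov.
apply/nbhs_alexandrov => q /pU[r rq Ur] V /nbhs_alexandrov qV.
by exists r; split=> //; exact: qV.
Qed.

(** If the cone of [p] is dense below [q] but [q <= p] fails, separativity yields [r <= q]
    incompatible with [p], whereas density yields an extension of [r] below [p]. *)
Lemma regopen_cone (p : P) : separative P -> regopen (cone p).
Proof.
move=> sep; apply/seteqP; split=> q.
  move=> /interior_closure_alexandrov qp; apply: contrapT => /sep[r rq].
  by apply; have [s sr sp] := qp _ rq; exists s.
by move=> qp; apply/interior_closure_alexandrov => r rq; exists r => //;
  exact: le_trans rq qp.
Qed.

Hypothesis sepP : separative P.

Lemma cone_neq_bot (p : P) : regopen_of (regopen_cone p sepP) != \bot.
Proof. by apply/ro_neq_bot; exists p; exact: lexx. Qed.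

Definition nonzero_cone (p : P) : nonzero (regular_opens alexandrov) :=
  exist (fun u => u != \bot) _ (cone_neq_bot p).

Lemma nonzero_cone_le (p q : P) : (nonzero_cone p <= nonzero_cone q) = (p <= q).
Proof.
rewrite leEsub; apply/idP/idP => [/regular_opens_le pq|pq].
  exact/pq/lexx.
by apply/regular_opens_le => r rp; exact: le_trans rp pq.
Qed.

Lemma nonzero_cone_dense (u : nonzero (regular_opens alexandrov)) :
  exists p, nonzero_cone p <= u.
Proof.
have [ou [p up]] := nonzero_open u; exists p.
by rewrite leEsub; apply/regular_opens_le => q qp; exact: ou qp up.
Qed.

End Alexandrov.

(** The witness is the meet of [q] with the complement of [p]: it is nonzero exactly because
    [q <= p] fails, and it is disjoint from [p]. *)
Lemma nonzero_separative (d : Order.disp_t) (B : ctbDistrLatticeType d) :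
  separative (nonzero B).
Proof.
move=> p q; rewrite leEsub => /negP qp.
have r0 : (val q `&` ~` val p)%O != \bot by rewrite disj_leC complK.
exists (exist (fun b => b != \bot) _ r0); first by rewrite leEsub; exact: leIl.
move=> [s []]; rewrite !leEsub /= lexI => /andP[_ sNp sp].
have : val s <= (val p `&` ~` val p)%O by rewrite lexI sp.
by rewrite meetxC lex0; apply/negP; exact: (valP s).
Qed.

(** * The Stone space of a Boolean algebra *)

Section Stone.
Context {d : Order.disp_t} (B : ctbDistrLatticeType d).

(** These are the homomorphisms into the two-element algebra, given as sets. Properness, upward
    closure and membership of [\top] follow from the two clauses. *)
Definition boolean_ultrafilter (F : set B) :=
  (forall x y, F (x `&` y)%O <-> F x /\ F y) /\
  (forall x, F (~` x)%O <-> ~ F x).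

Definition stone : Type := {F : set B | `[< boolean_ultrafilter F >]}.

HB.instance Definition _ := SubChoice.on stone.

Definition stone_open (U : set stone) :=
  forall F : stone, U F ->
    exists x, val F x /\ [set G : stone | val G x] `<=` U.

Lemma stoneP (F : stone) : boolean_ultrafilter (val F).
Proof. by apply/asboolP; exact: (valP F). Qed.

Lemma stoneI (F : stone) (x y : B) : val F (x `&` y)%O <-> val F x /\ val F y.
Proof. by have [] := stoneP F. Qed.

Lemma stoneC (F : stone) (x : B) : val F (~` x)%O <-> ~ val F x.
Proof. by have [] := stoneP F. Qed.

Lemma stone0 (F : stone) : ~ val F \bot.
Proof.
rewrite -(meetxC \bot%O) => /stoneI[F0]; exact/stoneC.
Qed.

Lemma stoneT (F : stone) : val F \top.
Proof. by rewrite -compl0; apply/stoneC/stone0. Qed.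

Lemma stone_openT : stone_open setT.
Proof. by move=> F _; exists \top; split=> //; exact: stoneT. Qed.

Lemma stone_openI : setI_closed stone_open.
Proof.
move=> U V oU oV F [/oU[x [Fx xU]] /oV[y [Fy yV]]].
exists (x `&` y)%O; split; first exact/stoneI.
by move=> G /stoneI[Gx Gy]; split; [exact: xU | exact: yV].
Qed.

Lemma stone_open_bigcup (I : Type) (f : I -> set stone) :
  (forall i, stone_open (f i)) -> stone_open (\bigcup_i f i).
Proof.
move=> of_ F [i _ /of_[x [Fx xf]]]; exists x; split=> //.
by move=> G /xf fiG; exists i.
Qed.

HB.instance Definition _ := isOpenTopological.Build stone
  stone_openT stone_openI stone_open_bigcup.

Definition stone_basic (x : B) : set stone := [set F | val F x].

Lemma stone_basicC (x : B) : stone_basic (~` x)%O = ~` (stone_basic x).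
Proof. by apply/seteqP; split=> F H; exact/stoneC. Qed.

Lemma open_stone_basic (x : B) : open (stone_basic x).
Proof. by move=> F Fx; exists x; split. Qed.

Lemma stone_baseP (F : stone) (U : set stone) :
  nbhs F U -> exists2 x, val F x & stone_basic x `<=` U.
Proof.
by rewrite nbhsE => -[V [oV /oV[x [Fx xV]] VU]]; exists x => // G /xV /VU.
Qed.

(* Zorn's lemma is applied to the filters all of whose members meet [x]; the
   empty set counts as one of them, as the union of the empty chain. *)
Lemma ex_boolean_ultrafilter (x : B) : x != \bot ->
  exists2 F, boolean_ultrafilter F & F x.
Proof.
move=> x0.
pose P : set (set B) := [set F | [/\ forall y z, F y -> F z -> F (y `&` z)%O,
  forall y z, y <= z -> F y -> F z & forall y, F y -> (x `&` y)%O != \bot]].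
have [|F [[FI Fup Fx] Fmax]] := @Zorn_bigcup _ P.
  move=> H HP Htot; split.
  - move=> y z [F HF Fy] [G HG Gz].
    have [FG|GF] := Htot _ _ HF HG.
      by exists G => //; have [+ _ _] := HP _ HG; apply=> //; exact: FG.
    by exists F => //; have [+ _ _] := HP _ HF; apply=> //; exact: GF.
  - move=> y z yz [F HF Fy]; exists F => //.
    by have [_ + _] := HP _ HF; apply; first exact: yz.
  - by move=> y [F HF Fy]; have [_ _] := HP _ HF; apply.
(* This excludes the empty set: an upward closed [F] without [\top] is empty, and the singleton of
   [\top] would be a larger member of [P]. *)
have FT : F \top.
  apply: contrapT => nFT.
  have F0 y : ~ F y by move=> Fy; apply/nFT/(Fup _ _ _ Fy)/lex1.
  apply: (Fmax [set \top]); last first.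
    split=> [_ _ -> ->|y z yz yT|_ ->]; first by rewrite meetxx.
    - by apply/eqP; rewrite -le1x -yT.
    - by rewrite meetx1.
  by split=> [y /F0//|]; apply/existsNP; exists \top; apply/not_implyP.
(* Maximality as a membership test: under this hypothesis the filter [G] generated by [F] and [y]
   still lies in [P], so it cannot properly extend [F]. *)
have ext y : (forall z, F z -> (x `&` (y `&` z))%O != \bot) -> F y.
  move=> yF; pose G := [set w | exists2 z, F z & (y `&` z)%O <= w].
  have FG : F `<=` G by move=> z Fz; exists z => //; exact: leIr.
  have Gy : G y by exists \top => //; exact: leIl.
  apply: contrapT => nFy; apply: (Fmax G).
    by split=> // /(_ _ Gy).
  split=> [v w [a Fa av] [b Fb bw]|v w vw [a Fa av]|w [a Fa aw]].
  - exists (a `&` b)%O; first exact: FI.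
    rewrite lexI (le_trans _ av) ?(le_trans _ bw)//; apply: leI2 => //.
      exact: leIr.
    exact: leIl.
  - by exists a => //; exact: le_trans av vw.
  - have := yF _ Fa; apply: contra; rewrite -!lex0; apply: le_trans.
    exact: leI2.
have Fn0 : ~ F \bot by move=> /Fx; rewrite meetx0 eqxx.
have FC y : F (~` y)%O <-> ~ F y.
  split=> [FCy Fy|nFy]; first by apply: Fn0; rewrite -(meetxC y); exact: FI.
  have /existsNP[a /not_implyP[Fa /negP/negPn/eqP xya0]] :
    ~ (forall z, F z -> (x `&` (y `&` z))%O != \bot) by move=> /ext.
  apply: ext => z Fz; have := Fx _ (FI _ _ Fa Fz).
  apply: contra => /eqP xyz0.
  (* [w] is nonzero since [x] meets every member of [F]. It is below [a], and [a] excludes [y]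
     within [x], so [w] is below the complement of [y]; then [xyz0] would force [w] to be [\bot]. *)
  set w := (x `&` (a `&` z))%O.
  have [wx wa wz] : [/\ w <= x, w <= a & w <= z].
    by split; rewrite /w ?leIl// leIx2// (leIl, leIr) orbT.
  have wCy : w <= (~` y)%O.
    by rewrite -disj_leC -lex0 -xya0 !lexI leIr (leIxl _ wx) (leIxl _ wa).
  by rewrite -lex0 -xyz0 !lexI wx wCy.
exists F; last by apply: ext => z /Fx; rewrite meetA meetxx.
split=> // y z; split=> [Fyz|[]]; last exact: FI.
by split; apply: Fup Fyz; [exact: leIl | exact: leIr].
Qed.

Lemma stone_basic_neq0 (x : B) : x != \bot -> stone_basic x !=set0.
Proof.
move=> /ex_boolean_ultrafilter[F /asboolP uF Fx].
by exists (exist _ F uF).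
Qed.

(** If [x <= y] fails, the meet of [x] with the complement of [y] is nonzero, and an ultrafilter
    containing it lies in the first basic set and outside the second. *)
Lemma stone_basicS (x y : B) : stone_basic x `<=` stone_basic y <-> x <= y.
Proof.
split=> [xy|/meet_idPl xy F].
  rewrite -[y]complK -disj_leC; apply: contrapT => /negP/stone_basic_neq0.
  by move=> [F /stoneI[/xy Fy /stoneC]].
by rewrite /stone_basic/= -xy => /stoneI[].
Qed.

Lemma stone_hausdorff : hausdorff_space stone.
Proof.
suff sep (F G : stone) x : val F x -> ~ val G x -> cluster (nbhs F) G -> False.
  move=> F G FG; apply/val_inj/seteqP; split=> x Fx; apply: contrapT => nGx.
    exact: (sep F G x).
  (* Passing to the complement of [x] handles the reverse inclusion without exchanging [F] and [G]
     in the cluster hypothesis. *)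
  apply: (sep F G (~` x)%O) => //; first exact/stoneC.
  by move=> /stoneC.
move=> Fx /stoneC Gx /(_ (stone_basic x) (stone_basic (~` x)%O)).
case; [| |by move=> H [Hx /stoneC]];
  by apply: open_nbhs_nbhs; split=> //; exact: open_stone_basic.
Qed.

(** An ultrafilter [U] on the space converges to the point formed by those [x] whose basic set
    belongs to [U]. *)
Lemma stone_compact : compact [set: stone].
Proof.
rewrite compact_ultra => U UU _.
pose F : set B := [set x | U (stone_basic x)].
have /asboolP uF : boolean_ultrafilter F.
  split=> [x y|x].
    have E : stone_basic (x `&` y)%O = stone_basic x `&` stone_basic y.
      by apply/seteqP; split=> G /stoneI.
    rewrite /F/= E; split=> [Uxy|[]]; last exact: filterI.
    by split; apply: filterS Uxy => G [].
  rewrite /F/= stone_basicC; split=> [UCx Ux|].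
    apply: (filter_not_empty U); rewrite -(setICr (stone_basic x)).
    exact: filterI.
  by have [] := in_ultra_setVsetC (stone_basic x) UU.
exists (exist _ F uF); split=> // V /stone_baseP[x Fx xV].
exact: filterS xV Fx.
Qed.

Lemma stone_stone_space : stone_space stone.
Proof.
split; [exact: stone_hausdorff | exact: stone_compact |].
move=> F U oU UF; have [x [Fx xU]] := oU _ UF.
exists (stone_basic x); split=> //; split; first exact: open_stone_basic.
by rewrite -[stone_basic x]setCK closedC -stone_basicC; exact: open_stone_basic.
Qed.

Lemma nonempty_open_stone_basic (x : nonzero B) :
  nonempty_open (stone_basic (val x)).
Proof.
by split; [exact: open_stone_basic | exact/stone_basic_neq0/(valP x)].
Qed.

Definition opens_of_stone_basic (x : nonzero B) : opens stone :=
  exist _ (stone_basic (val x)) (asboolT (nonempty_open_stone_basic x)).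

Lemma opens_of_stone_basic_le (x y : nonzero B) :
  (opens_of_stone_basic x <= opens_of_stone_basic y) = (x <= y).
Proof.
rewrite [RHS]leEsub; apply/idP/idP => [/opens_le/stone_basicS//|xy].
exact/opens_le/stone_basicS.
Qed.

Lemma opens_of_stone_basic_dense (U : opens stone) :
  exists x, opens_of_stone_basic x <= U.
Proof.
have [oU [F /oU[x [Fx xU]]]] := opensP U.
have x0 : x != \bot by apply/eqP => x0; move: Fx; rewrite x0; exact: stone0.
by exists (exist _ x x0); apply/opens_le.
Qed.

End Stone.

(** * The circle of implications *)

Lemma stone_space_quasi_regular (X : topologicalType) :
  stone_space X -> quasi_regular X.
Proof.
move=> [hX _ bX]; split=> // U [oU [x Ux]].
have [V [[oV cV] Vx VU]] := bX _ _ oU Ux.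
exists V; split=> //; first by split=> //; exists x.
by rewrite -(closure_id V).1.
Qed.

Theorem theorem2p10 :
  [/\ separative_pi_nt_le <->
        (forall (d : Order.disp_t) (B : ctbDistrLatticeType d),
           card_leq (pi_nt (nonzero B)) (souslin (nonzero B))),
      separative_pi_nt_le <->
        (forall X : topologicalType, stone_space X ->
           card_leq (pi_nt_space X) (souslin_space X))
    & separative_pi_nt_le <->
        (forall X : topologicalType, quasi_regular X ->
           card_leq (pi_nt_space X) (souslin_space X))].
Proof.
(* In the names below, [0] stands for [separative_pi_nt_le] and [1], [2], [3] for Boolean algebras,
   Stone spaces and quasi-regular spaces; the path is 0, 1, 3, 2, 1, 0. *)
have H1 : separative_pi_nt_le -> forall d (B : ctbDistrLatticeType d),
    card_leq (pi_nt (nonzero B)) (souslin (nonzero B)).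
  by move=> H d B; exact/H/nonzero_separative.
have H13 : (forall d (B : ctbDistrLatticeType d),
    card_leq (pi_nt (nonzero B)) (souslin (nonzero B))) ->
  forall X : topologicalType, quasi_regular X ->
    card_leq (pi_nt_space X) (souslin_space X).
  move=> H X qX; apply/pi_nt_le_souslin_opens.
  apply/(pi_nt_le_souslin_embed (@opens_of_nonzero_le X)
    (opens_of_nonzero_dense qX)).
  exact: H.
have H32 : (forall X : topologicalType, quasi_regular X ->
    card_leq (pi_nt_space X) (souslin_space X)) ->
  forall X : topologicalType, stone_space X ->
    card_leq (pi_nt_space X) (souslin_space X).
  by move=> H X /stone_space_quasi_regular; exact: H.
have H21 : (forall X : topologicalType, stone_space X ->
    card_leq (pi_nt_space X) (souslin_space X)) ->
  forall d (B : ctbDistrLatticeType d),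
    card_leq (pi_nt (nonzero B)) (souslin (nonzero B)).
  move=> H d B; apply/(pi_nt_le_souslin_embed (@opens_of_stone_basic_le _ B)
    (@opens_of_stone_basic_dense _ B)).
  exact/pi_nt_le_souslin_opens/H/stone_stone_space.
have H10 : (forall d (B : ctbDistrLatticeType d),
    card_leq (pi_nt (nonzero B)) (souslin (nonzero B))) ->
  separative_pi_nt_le.
  move=> H d P sP; apply/(pi_nt_le_souslin_embed (nonzero_cone_le sP)
    (nonzero_cone_dense sP)).
  exact: H.
by split; split; eauto.
Qed.
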